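(* There is a function $D$ assigning to each pair of non-zero integers $l\le r$ a non-negative integer $D(l,r)$ such that the following holds. Let $R$ be a ring with unit, let $A$ be an $R$-algebra with group of units $U(A)$, and suppose that $U(A)$ satisfies a Laurent polynomial identity $P=a_1+a_2w_2+\cdots+a_tw_t$ over $R$ in which every non-constant word $w_i$ ($2\le i\le t$) has non-zero sum of exponents in at least one of the variables. Let $l$ and $r$ be respectively the minimum and the maximum of the exponent sums of the words $w_2,\dots,w_t$ (with the convention on exponent sums given in the context). Then there exists a non-zero polynomial $f\in R[X]$ of degree $d=D(l,r)$ such that for all $a,b,c,u\in A$ with $a^2=bc=0$ one has $$f(bacu)=0.$$ Thus, for all $a,b,c\in A$ with $a^2=bc=0$, the right ideal $bacA$ satisfies a polynomial identity (a non-zero polynomial over $R$ vanishing on $bacA$).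
   Context: Algebras are associative with unit; $U(A)$ is the group of units of $A$. Let $F=\langle x_1,\dots,x_m\rangle$ be a free group. A Laurent polynomial over $R$ in the non-commuting variables $x_1,\dots,x_m$ is a non-zero element $P$ of the group ring $RF$. $P$ is a Laurent polynomial identity (LPI) for $U(A)$ if $P(c_1,\dots,c_m)=0$ in $A$ for all $c_1,\dots,c_m\in U(A)$. $P$ is written $P=a_1+a_2w_2+\cdots+a_tw_t$, where $t\ge 2$, the $a_i\in R$ are non-zero (in particular the constant coefficient $a_1$ is non-zero), and $w_2,\dots,w_t$ are distinct non-trivial elements (the non-constant words) of $F$. For a word $w\in F$, $\sum \exp_{x_j} w$ denotes the sum of the exponents of $x_j$ in $w$, and $\sum \exp w=\sum_{j}\sum\exp_{x_j}w$ is the total exponent sum. Convention on exponent sums: if all total exponent sums $\sum\exp w_i$ are non-zero, they are used to define $l=\min_i\sum\exp w_i$ and $r=\max_i\sum\exp w_i$. If some $\sum\exp w_i$ is zero, one first replaces the variables $x_j$ by positive powers $x_j^{k_j}$ so that in the new Laurent polynomial identity all total exponent sums $\sum_j k_j\sum\exp_{x_j}w_i$ are non-zero (possible because each $w_i$ has a non-zero exponent sum in some variable), and $l,r$ are the minimum and maximum of these new total exponent sums. *)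

(* Defs.v *)
From HB Require Import structures.
From mathcomp Require Import all_boot all_order all_algebra.
From mathcomp Require Export finmap.
From mathcomp.multinomials Require Export monalg.

Set Implicit Arguments.
Unset Strict Implicit.
Unset Printing Implicit Defensive.

Import Order.TTheory GRing.Theory Num.Theory.
Local Open Scope ring_scope.

(* The free group on x_0, ..., x_(m-1), as reduced words: the letter (j, true)
   is x_j and (j, false) is its inverse. *)
Definition letter (m : nat) := ('I_m * bool)%type.
Definition linv m (x : letter m) : letter m := (x.1, ~~ x.2).
Definition reduced m (s : seq (letter m)) : bool :=
  sorted (fun x y => y != linv x) s.

Record free_group (m : nat) := FreeGroup {
  word :> seq (letter m);
  word_reduced : reduced word
}.
HB.instance Definition _ m := [isSub for @word m].
HB.instance Definition _ m := [Choice of free_group m by <:].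

Definition lcons m (x : letter m) (s : seq (letter m)) :=
  if s is y :: s' then if y == linv x then s' else x :: s else [:: x].

Section FreeGroupLaw.
Variable m : nat.
Implicit Types (x : letter m) (s : seq (letter m)) (u v w : free_group m).

Lemma linvK : involutive (@linv m).
Proof. by case=> j b; rewrite /linv negbK. Qed.

Lemma lcons_reduced x s : reduced s -> reduced (lcons x s).
Proof.
case: s => [|y s] //= ps; case: ifP => [_|/negbT xy /=]; last by rewrite xy.
exact: path_sorted ps.
Qed.

Lemma lcons_id x s : reduced (x :: s) -> lcons x s = x :: s.
Proof. by case: s => [|y s] //= /andP[/negbTE ->]. Qed.

Lemma lconsK x s : reduced s -> lcons (linv x) (lcons x s) = s.
Proof.
case: s => [|y s] /= ps; first by rewrite linvK eqxx.
case: eqP => [<-|_] /=; last by rewrite linvK eqxx.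
exact: lcons_id.
Qed.

Lemma lcons_foldr_reduced s t : reduced t -> reduced (foldr (@lcons m) t s).
Proof. by move=> rt; elim: s => //= x s; apply: lcons_reduced. Qed.

Lemma foldr_lcons x s t : reduced t ->
  foldr (@lcons m) t (lcons x s) = lcons x (foldr (@lcons m) t s).
Proof.
move=> rt; case: s => [|y s] //=; case: eqP => // ->.
by rewrite -{1}(linvK x) lconsK ?lcons_foldr_reduced.
Qed.

Lemma foldr_lcons_nil s : reduced s -> foldr (@lcons m) [::] s = s.
Proof.
elim: s => //= x s IHs rxs; rewrite IHs ?lcons_id //.
exact: path_sorted rxs.
Qed.

Lemma linv_rev_reduced s : reduced s -> reduced (rev (map (@linv m) s)).
Proof.
rewrite /reduced rev_sorted sorted_map; apply: sub_sorted => x y /=.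
by rewrite /relpre /= linvK eq_sym => /negbTE ->.
Qed.

Lemma foldr_linv s t : reduced t ->
  foldr (@lcons m) (foldr (@lcons m) t s) (rev (map (@linv m) s)) = t.
Proof.
move=> rt; elim: s => //= x s IHs.
by rewrite rev_cons foldr_rcons lconsK ?lcons_foldr_reduced.
Qed.

Definition fg_one : free_group m := @FreeGroup m [::] isT.
Definition fg_mul u v : free_group m :=
  FreeGroup (lcons_foldr_reduced u (word_reduced v)).
Definition fg_inv u : free_group m :=
  FreeGroup (linv_rev_reduced (word_reduced u)).

Lemma fg_mulA : associative fg_mul.
Proof.
move=> u v w; apply: val_inj => /=.
elim: (word u) => //= x s ->; rewrite foldr_lcons //; exact: word_reduced.
Qed.

Lemma fg_mul1 : left_id fg_one fg_mul.
Proof. by move=> u; apply: val_inj. Qed.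

Lemma fg_mulr1 : right_id fg_one fg_mul.
Proof.
move=> u; apply: val_inj; exact: (foldr_lcons_nil (word_reduced u)).
Qed.

Lemma fg_mulV : left_inverse fg_one fg_inv fg_mul.
Proof.
move=> u; apply: val_inj => /=.
by rewrite -{1}(foldr_lcons_nil (word_reduced u)) foldr_linv.
Qed.

Lemma fg_mulrV : right_inverse fg_one fg_inv fg_mul.
Proof.
move=> u; rewrite -[X in fg_mul X _](_ : fg_inv (fg_inv u) = u) ?fg_mulV //.
by apply: val_inj; rewrite /= map_rev revK (mapK linvK).
Qed.

HB.instance Definition _ := isGroup.Build (free_group m)
  fg_mulA fg_mul1 fg_mulr1 fg_mulV fg_mulrV.

End FreeGroupLaw.

(* The sum of the exponents of x_j in w. *)
Definition exp_var m (j : 'I_m) (w : free_group m) : int :=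
  \sum_(x <- word w | x.1 == j) (if x.2 then 1 else -1).

(* The total exponent sum of w after the substitution x_j := x_j ^ (k j);
   the plain total exponent sum is the case where k is constantly 1. *)
Definition exp_sum m (k : 'I_m -> nat) (w : free_group m) : int :=
  \sum_(j < m) (k j)%:Z * exp_var j w.

(* Only the R-module underlying the group ring RF is needed; multinomials
   endows {malg R[K]} with a product only when K has no non-trivial units. *)
Definition laurent (R : nzRingType) (m : nat) := {malg R[free_group m]}.

Section Laurent.
Variables (R : nzRingType) (m : nat).
Implicit Types P : laurent R m.

Definition nonconst_word P (w : free_group m) : bool :=
  (w \in msupp P) && (w != 1%g).

Definition word_eval (A : unitRingType) (c : 'I_m -> A) (w : free_group m) : A :=
  \prod_(x <- word w) (if x.2 then c x.1 else (c x.1)^-1).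

Definition laurent_eval (A : unitAlgType R) (c : 'I_m -> A) P : A :=
  \sum_(w <- msupp P) P@_w *: word_eval c w.

Definition LPI (A : unitAlgType R) P : Prop :=
  P != 0 /\
  forall c : 'I_m -> A, (forall j, c j \is a GRing.unit) -> laurent_eval c P = 0.

(* The exponents k allowed by the convention on exponent sums: no replacement
   (k = 1) when all the plain sums are non-zero, and otherwise any positive
   powers making all the new sums non-zero. *)
Definition admissible P (k : 'I_m -> nat) : Prop :=
  [/\ forall j, (0 < k j)%N,
      forall w, nonconst_word P w -> exp_sum k w != 0
    & (forall w, nonconst_word P w -> exp_sum (fun=> 1%N) w != 0) ->
      forall j, k j = 1%N].

Definition min_exp_sum P (k : 'I_m -> nat) (l : int) : Prop :=
  (exists2 w, nonconst_word P w & exp_sum k w = l) /\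
  (forall w, nonconst_word P w -> l <= exp_sum k w).

Definition max_exp_sum P (k : 'I_m -> nat) (r : int) : Prop :=
  (exists2 w, nonconst_word P w & exp_sum k w = r) /\
  (forall w, nonconst_word P w -> exp_sum k w <= r).

End Laurent.

Definition right_ideal (A : nzRingType) (x : A) (y : A) : Prop :=
  exists u : A, y = x * u.

Definition satisfies_PI (R : nzRingType) (A : algType R) (S : A -> Prop) : Prop :=
  exists2 f : {poly R}, f != 0 & forall y, S y -> horner_alg y f = 0.

(* Main.v *)
Require Import Defs.
From HB Require Import structures.
From mathcomp Require Import all_boot all_order all_algebra.
From mathcomp Require Import zify.

Set Implicit Arguments.
Unset Strict Implicit.
Unset Printing Implicit Defensive.

Import Order.TTheory GRing.Theory Num.Theory.
Local Open Scope ring_scope.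

(** The unipotent elements [1 + a] and [1 + cub] are units since
    [a^2 = bc = 0]; let [g] be their product and let [y = bacu].  The powers of
    [g] see [y] through the formula [(ba) g^n (cu) = p_n(y) y], where [p_n] is an
    integer polynomial that is monic of degree [n - 1] for [n > 0]
    ([power_coefs_monic], [power_coefs_eval]).  Substituting [x_j := g^(k_j)] in
    the Laurent polynomial identity turns each word [w] into the power of [g]
    whose exponent is the exponent sum [e_w] of [w] weighted by [k].  Once
    multiplied by a power [g^s] that makes all exponents positive, the identity
    becomes [sum_w a_w L_(e_w + s)(y) = 0] with [L_n = X p_n]
    ([power_poly_relation]).

    The coefficient that is known to be non-zero is that of the trivial word,
    whose index is [s]; the sum of the coefficients of all words of some other
    exponent sum may vanish, so the relation above could be trivial or have an
    uncontrolled leading coefficient.  The remedy is that the set of the elements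
    [bacu] is closed under squaring, as [y^2 = bac(u y)].  The relation therefore
    also holds at [y^2], and the combination of [L_j(y^2)] times the relation at
    [y] with [L_j(y)] times the relation at [y^2] has no term of index [j].
    Applied to the largest index [j], this leaves the other polynomials monic
    with strictly increasing degrees ([eliminate_staircase]).  Repeating it until
    no index above [s] is left yields a relation whose only term of top degree is
    the one of the trivial word, with leading coefficient [a_1]: this is [f]
    ([relation_poly]).  Its degree is that of an integer polynomial that depends
    only on [s] and on the number of eliminations, hence on [l] and [r].

    For the last assertion, positive exponents [k_j] making all the weighted
    exponent sums non-zero are found among the sequences [t^j]
    ([exists_nonzero_exp_sums]). *)

(** * Polynomials with integer coefficients evaluated in an algebra *)

(** Evaluating integer polynomials gives a ring morphism from a commutative ring,
    so that values at the same point commute although [R] and [A] may not be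
    commutative; and the degrees that occur do not depend on [R]. *)
Definition int_eval (R : nzRingType) (A : algType R) (y : A)
  : {poly int} -> A := horner_alg y \o map_poly intr.

HB.instance Definition _ R A y :=
  GRing.RMorphism.copy (@int_eval R A y) (horner_alg y \o map_poly intr).

Section IntEval.
Variables (R : nzRingType) (A : algType R).
Implicit Types (y : A) (p : {poly int}).

Lemma int_evalX y : int_eval y 'X = y.
Proof. by rewrite /int_eval /= map_polyX horner_algX. Qed.

Lemma int_eval_compX2 y p : int_eval y (p \Po 'X^2) = int_eval (y ^+ 2) p.
Proof.
elim/poly_ind: p => [|p c IHp]; first by rewrite comp_poly0 !rmorph0.
rewrite comp_polyD comp_polyM comp_polyX comp_polyC 2!rmorphD 2!rmorphM /= IHp.
by rewrite rmorphXn /= !int_evalX /int_eval /= !map_polyC !horner_algC.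
Qed.

Lemma horner_algZ y (a : R) (p : {poly R}) :
  horner_alg y (a *: p) = a *: horner_alg y p.
Proof. by rewrite -mul_polyC rmorphM /= horner_algC mulr_algl. Qed.

End IntEval.

(** * Powers of a product of two unipotent elements *)

(** For [g = (1 + a)(1 + cub)] the span of [ba] and [yb] over the polynomials in
    [y] is stable by right multiplication by [g], with [ba g = ba + yb] and
    [b g = b + ba + yb].  These are the coordinates of [ba g^n]. *)
Fixpoint power_coefs (n : nat) : {poly int} * {poly int} :=
  if n is n'.+1 then
    let: (p, q) := power_coefs n' in (p + q * 'X, p + q + q * 'X)
  else (1, 0).

Lemma power_coefsS n (p := (power_coefs n).1) (q := (power_coefs n).2) :
  power_coefs n.+1 = (p + q * 'X, p + q + q * 'X).
Proof. by rewrite /p /q /=; case: (power_coefs n). Qed.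

Lemma monic_size_addl (R : nzRingType) (p q : {poly R}) n :
  q \is monic -> size q = n -> (size p < n)%N ->
  p + q \is monic /\ size (p + q) = n.
Proof.
move=> mq sq lt_pn; rewrite -sq in lt_pn *.
by rewrite addrC monicE lead_coefDl // size_polyDl.
Qed.

(** The terms [q * 'X] dominate both recurrences. *)
Lemma power_coefs_monic n (pq := power_coefs n.+1) :
  [/\ pq.1 \is monic, pq.2 \is monic, size pq.1 = n.+1 & size pq.2 = n.+1].
Proof.
rewrite {}/pq; elim: n => [|n].
  by rewrite /= mul0r !addr0 monic1 size_poly1.
rewrite (power_coefsS n.+1); case: (power_coefs n.+1) => p q /=.
case=> _ mq sp sq.
have mqX : q * 'X \is monic by rewrite monicMr ?monicX.
have sqX : size (q * 'X) = n.+2 by rewrite size_mulX ?monic_neq0 // sq.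
have [|-> ->] := monic_size_addl mqX sqX (p := p); first by rewrite sp.
have [|-> ->] // := monic_size_addl mqX sqX (p := p + q).
by rewrite (leq_ltn_trans (size_polyD _ _)) // sp sq maxnn.
Qed.

Section UnipotentProduct.
Variables (R : nzRingType) (A : unitAlgType R).

Lemma unipotent_unit (x : A) : x * x = 0 -> 1 + x \is a GRing.unit.
Proof.
move=> xx; apply/unitrP; exists (1 - x).
by rewrite !(mulrDl, mulrDr) !mulNr !mulrN xx !mul1r !mulr1 oppr0 !addr0 subrK addrK.
Qed.

Variables a b c u : A.
Hypotheses (a2 : a * a = 0) (bc : b * c = 0).
Let y := b * a * c * u.
Let g := (1 + a) * (1 + c * u * b).

Lemma unipotent_product_unit : g \is a GRing.unit.
Proof.
have nilp : c * u * b * (c * u * b) = 0.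
  by rewrite -!mulrA (mulrA b c) bc mul0r !mulr0.
by rewrite unitrMl; apply: unipotent_unit.
Qed.

Lemma power_coefsP n :
  b * a * g ^+ n = int_eval y (power_coefs n).1 * (b * a)
                   + int_eval y (power_coefs n).2 * (y * b).
Proof.
have bg : b * g = b + b * a + y * b.
  rewrite /g /y !(mulrDl, mulrDr) !mulr1 mul1r !mulrA bc !mul0r addr0.
  by rewrite addrA.
have bag : b * a * g = b * a + y * b.
  rewrite -mulrA /g !(mulrDl, mulrDr) !mulr1 mul1r !mulrA -(mulrA b a a) a2.
  by rewrite mulr0 !mul0r !addr0.
elim: n => [|n IHn].
  by rewrite expr0 mulr1 rmorph1 rmorph0 mul1r mul0r addr0.
rewrite exprSr mulrA IHn power_coefsS; case: (power_coefs n) => p q /=.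
rewrite mulrDl -!mulrA bg (mulrA b a g) bag !rmorphD !rmorphM /= int_evalX.
rewrite !mulrDl !mulrDr -!mulrA.
rewrite -!addrA; congr (_ + _); rewrite addrCA [RHS]addrCA; congr (_ + _).
Qed.

(** Multiplying by [cu] on the right kills the second coordinate since [bc = 0],
    and turns [ba] into [y]. *)
Lemma power_coefs_eval n :
  b * a * g ^+ n * (c * u) = int_eval y ((power_coefs n).1 * 'X).
Proof.
rewrite power_coefsP mulrDl -[X in _ + X]mulrA -(mulrA y b).
by rewrite (mulrA b c u) bc mul0r !mulr0 addr0 rmorphM /= int_evalX /y -!mulrA.
Qed.

End UnipotentProduct.

(** * Eliminating the coefficients of large index *)

(** A relation that holds at [y] and at [y^2] gives two equations at [y], with
    polynomials [L n] and [L n \Po 'X^2]; cross-multiplying by the two entries of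
    index [j] cancels that index. *)
Definition eliminate (j : nat) (L : nat -> {poly int}) (n : nat) : {poly int} :=
  L n * (L j \Po 'X^2) - (L n \Po 'X^2) * L j.

(** Indices are eliminated in the order [s + k], ..., [s + 1]: the largest first,
    so that the degree of the eliminated polynomial is the largest at each
    step. *)
Fixpoint sieve (s k : nat) (L : nat -> {poly int}) : nat -> {poly int} :=
  if k is k'.+1 then sieve s k' (eliminate (s + k) L) else L.

Definition staircase (j : nat) (L : nat -> {poly int}) : Prop :=
  (forall n, (0 < n <= j)%N -> L n \is monic) /\
  (forall n n', (0 < n)%N -> (n < n' <= j)%N -> (size (L n) < size (L n'))%N).

Lemma monic_compX2 (p : {poly int}) : p \is monic ->
  p \Po 'X^2 \is monic /\ size (p \Po 'X^2) = ((size p).-1 * 2).+1.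
Proof.
move=> mp; have s2 : (1 < size ('X^2 : {poly int}))%N by rewrite size_polyXn.
split; first by rewrite monicE lead_coef_comp // lead_coefXn expr1n mulr1 -monicE.
have := size_comp_poly p 'X^2; rewrite size_polyXn /= => <-.
by rewrite prednK // size_poly_gt0 comp_poly_eq0 // monic_neq0.
Qed.

(** With [d] and [e] the degrees of [L n] and [L j], the two products have degrees
    [d + 2e] and [2d + e]; the first is larger when [d < e]. *)
Lemma eliminate_monic j L n : L j \is monic -> L n \is monic ->
  (size (L n) < size (L j))%N ->
  eliminate j L n \is monic /\
  size (eliminate j L n) = (size (L n) + (size (L j)).-1 * 2)%N.
Proof.
move=> mj mn lt_nj; have [m2j s2j] := monic_compX2 mj.
have [m2n s2n] := monic_compX2 mn.
have nzj := size_poly_gt0 (L j); rewrite monic_neq0 // in nzj.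
have nzn := size_poly_gt0 (L n); rewrite monic_neq0 // in nzn.
rewrite /eliminate addrC; apply: monic_size_addl.
- by rewrite monicMr.
- by rewrite size_Mmonic ?monic_neq0 // s2j addnS.
- rewrite size_polyN size_Mmonic ?monic_neq0 // s2n.
  by move: (size (L n)) (size (L j)) lt_nj nzj nzn => x z; lia.
Qed.

(** The elimination adds the same number, twice the degree of the eliminated
    polynomial, to all degrees, so they stay in the same order. *)
Lemma eliminate_staircase j L :
  staircase j.+1 L -> staircase j (eliminate j.+1 L).
Proof.
case=> mL sL.
have elimP n : (0 < n <= j)%N -> eliminate j.+1 L n \is monic /\
    size (eliminate j.+1 L n) = (size (L n) + (size (L j.+1)).-1 * 2)%N.
  by move=> le_nj; apply: eliminate_monic; rewrite ?mL ?sL //; lia.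
split=> [n /elimP[] // | n n' n_gt0 le_n'j].
have [_ ->] := elimP n ltac:(lia); have [_ ->] := elimP n' ltac:(lia).
by rewrite ltn_add2r sL //; lia.
Qed.

Lemma sieve_staircase s k L :
  staircase (s + k) L -> staircase s (sieve s k L).
Proof.
elim: k L => [|k IHk] L; first by rewrite addn0.
by rewrite addnS => /eliminate_staircase/IHk; rewrite /= addnS.
Qed.

Lemma sieve_eq0 s k L n : L n = 0 \/ (s < n <= s + k)%N -> sieve s k L n = 0.
Proof.
elim: k L => [|k IHk] L /= Ln; first by case: Ln => //; lia.
apply: IHk; case: Ln => [Ln | le_n].
  by left; rewrite /eliminate Ln comp_poly0 !mul0r subrr.
have [->|ne_n] := eqVneq n (s + k.+1)%N; last by right; lia.
by left; rewrite /eliminate mulrC subrr.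
Qed.

Definition power_poly (n : nat) : {poly int} := (power_coefs n).1 * 'X.

Lemma power_poly_monic n : power_poly n.+1 \is monic.
Proof. by rewrite monicMr ?monicX //; case: (power_coefs_monic n). Qed.

Lemma size_power_poly n : size (power_poly n.+1) = n.+2.
Proof.
have [m1 _ s1 _] := power_coefs_monic n.
by rewrite size_mulX ?monic_neq0 // s1.
Qed.

Lemma power_poly_staircase j : staircase j power_poly.
Proof.
split=> [[|n] // _|[|n] [|n'] // _]; first exact: power_poly_monic.
by rewrite !size_power_poly; lia.
Qed.

Section Relation.
Variables (R : nzRingType) (A : algType R) (I : eqType) (r : seq I).
Variables (coef : I -> R) (idx : I -> nat) (Y : A -> Prop).
Hypothesis Ysqr : forall y, Y y -> Y (y ^+ 2).

Definition relation (L : nat -> {poly int}) : Prop :=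
  forall y, Y y -> \sum_(i <- r) coef i *: int_eval y (L (idx i)) = 0.

Lemma eliminate_relation j L : relation L -> relation (eliminate j L).
Proof.
move=> relL y Yy; rewrite /eliminate.
under eq_bigr => i _ do
  rewrite rmorphB !rmorphM /= !int_eval_compX2 scalerBr !scalerAl.
by rewrite sumrB -!mulr_suml !relL ?mul0r ?subrr //; apply: Ysqr.
Qed.

Lemma sieve_relation s k L : relation L -> relation (sieve s k L).
Proof. by elim: k L => //= k IHk L /(@eliminate_relation (s + k.+1))/IHk. Qed.

(** After the sieve, [i0] is alone at the largest index left, so its polynomial
    has a larger degree than all others and its coefficient is the leading
    coefficient of the sum. *)
Lemma relation_poly s k i0 : uniq r -> i0 \in r -> coef i0 != 0 ->
  idx i0 = s.+1 ->
  {in r, forall i, i != i0 -> [/\ 0 < idx i, idx i != s.+1 & idx i <= s.+1 + k]%N} ->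
  relation power_poly ->
  exists2 f : {poly R}, size f = size (sieve s.+1 k power_poly s.+1) &
    forall y, Y y -> horner_alg y f = 0.
Proof.
move=> Ur ri0 nz0 idx0 idxP /(@sieve_relation s.+1 k) relS.
have [mS sS] := sieve_staircase (power_poly_staircase (s.+1 + k)).
set S := sieve _ _ _ in relS mS sS *.
exists (\sum_(i <- r) coef i *: map_poly intr (S (idx i))); last first.
  move=> y /relS; apply: etrans; rewrite raddf_sum /=.
  by apply: eq_bigr => i _; rewrite horner_algZ.
have mS0 : S s.+1 \is monic by rewrite mS // leqnn.
have szS (p : {poly int}) : p \is monic ->
    size (map_poly intr p : {poly R}) = size p.
  by move=> mp; rewrite size_map_poly_id0 // (monicP mp) oner_eq0.
rewrite (bigD1_seq i0) //= idx0.
have s0 : size (coef i0 *: map_poly intr (S s.+1) : {poly R}) = size (S s.+1).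
  by rewrite -mul_polyC size_Mmonic ?polyC_eq0 ?monic_map // size_polyC nz0 szS.
rewrite size_polyDl s0 //.
rewrite big_seq_cond; apply: (leq_ltn_trans (size_sum _ _ _)).
have S_gt0 : (0 < size (S s.+1))%N by rewrite size_poly_gt0 monic_neq0.
rewrite -(prednK S_gt0) ltnS; apply/bigmax_leqP_seq => i _ /andP[ri ne_i0].
rewrite -ltnS prednK //; apply: (leq_ltn_trans (size_scale_leq _ _)).
have [n_gt0 n_neq n_le] := idxP i ri ne_i0.
case: (ltnP s.+1 (idx i)) => [lt_n | le_n].
  by rewrite /S sieve_eq0 ?rmorph0 ?size_poly0 //; right; rewrite lt_n.
rewrite szS ?sS ?mS ?n_gt0 //; last by rewrite leqnn andbT ltn_neqAle n_neq.
Qed.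

End Relation.

(** * Specializing a Laurent polynomial to one variable *)

Section Specialization.
Variable m : nat.
Implicit Types (k : 'I_m -> nat) (w : free_group m).

(** The definition groups the letters of the word by variable; here they are
    taken in the order in which the evaluation of the word multiplies them. *)
Lemma exp_sumE k w :
  exp_sum k w = \sum_(x <- word w) (k x.1)%:Z * (if x.2 then 1 else -1).
Proof.
rewrite /exp_sum /exp_var; under eq_bigr => j _ do rewrite mulr_sumr.
rewrite (exchange_big_dep predT) //=; apply: eq_bigr => x _.
by rewrite (big_pred1 x.1) // => j; rewrite eq_sym.
Qed.

Lemma word_eval_pow (A : unitRingType) (g : A) k w : g \is a GRing.unit ->
  word_eval (fun j => g ^+ k j) w = g ^ exp_sum k w.
Proof.
move=> Ug; rewrite exp_sumE /word_eval.
elim: (word w) => [|[j e] s IHs]; first by rewrite !big_nil.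
rewrite !big_cons IHs exprzDr //=; congr (_ * _).
by case: e; rewrite ?mulr1 // mulrN1 -exprnN.
Qed.

Lemma exp_sum1 k : exp_sum k 1%g = 0.
Proof. by rewrite exp_sumE big_nil. Qed.

(** With [k_j = t^j] the weighted exponent sum of a word is the value at [t] of
    the non-zero polynomial whose coefficients are its exponent sums in each
    variable; the product of these polynomials has finitely many roots, so some
    positive integer [t] avoids them all. *)
Lemma exists_nonzero_exp_sums (ws : seq (free_group m)) :
  {in ws, forall w, exists j, exp_var j w != 0} ->
  exists2 k : 'I_m -> nat, forall j, (0 < k j)%N &
    {in ws, forall w, exp_sum k w != 0}.
Proof.
move=> wsP; pose q w : {poly int} := \sum_(j < m) exp_var j w *: 'X^j.
have q_neq0 w : w \in ws -> q w != 0.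
  move=> /wsP[j nz_j]; apply: contraNneq nz_j => /(congr1 (fun p : {poly int} => p`_j)).
  rewrite coef0 /q coef_sum (bigD1 j) //= coefZ coefXn eqxx mulr1.
  rewrite big1 ?addr0 => [-> //|i ne_ij]; rewrite coefZ coefXn.
  by rewrite (inj_eq val_inj) eq_sym (negbTE ne_ij) mulr0.
pose Q := \prod_(w <- ws) q w.
have Q_neq0 : Q != 0 by rewrite prodf_seq_neq0; apply/allP => w /q_neq0.
pose ts : seq int := [seq i.+1%:Z | i <- iota 0 (size Q)].
have Uts : uniq ts by rewrite map_inj_uniq ?iota_uniq // => i j [].
have : ~~ all (root Q) ts.
  apply/negP=> rootQ; have := max_poly_roots Q_neq0 rootQ Uts.
  by rewrite size_map size_iota ltnn.
case/allPn=> _ /mapP[t _ ->] nroot; exists (fun j => t.+1 ^ j)%N => [j|w ws_w].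
  by rewrite expn_gt0.
apply: contraNneq nroot => e0; rewrite /root /Q horner_prod prodf_seq_eq0.
apply/hasP; exists w => //=; rewrite -e0 /exp_sum /q horner_sum; apply/eqP.
by apply: eq_bigr => j _; rewrite hornerZ hornerXn mulrC -[Posz (_ ^ _)]natz natrX natz.
Qed.

End Specialization.

(** * The polynomial identity *)

Definition identity_degree (p q : nat) : nat :=
  (size (sieve p.+1 q power_poly p.+1)).-1.

Section Identity.
Variables (R : nzRingType) (A : unitAlgType R) (m : nat) (P : laurent R m).
Hypotheses (lpiP : LPI A P) (P1 : P@_1%g != 0).

Definition square_zero_product (y : A) : Prop :=
  exists a b c u : A, [/\ a ^+ 2 = 0, b * c = 0 & y = b * a * c * u].

Lemma square_zero_product_sqr y :
  square_zero_product y -> square_zero_product (y ^+ 2).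
Proof.
case=> a [b [c [u [a2 bc ->]]]]; exists a, b, c, (u * (b * a * c * u)).
by split; rewrite // expr2 !mulrA.
Qed.

(** The relation is the identity at [x_j := g^(k_j)], multiplied by [ba g^s] on
    the left and by [cu] on the right. *)
Lemma power_poly_relation k (s : nat) :
  {in msupp P, forall w, 0 <= exp_sum k w + s%:Z} ->
  relation (msupp P) (fun w => P@_w) (fun w => absz (exp_sum k w + s%:Z))
    square_zero_product power_poly.
Proof.
move=> sP _ [a [b [c [u [a2 bc ->]]]]]; rewrite expr2 in a2.
have Ug := unipotent_product_unit u a2 bc; set g := (_ * _) in Ug.
have := lpiP.2 (fun j => g ^+ k j) (fun j => unitrX _ Ug).
move=> /(congr1 (fun x => b * a * g ^+ s * x * (c * u))).
rewrite mulr0 mul0r /laurent_eval mulr_sumr mulr_suml; apply: etrans.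
apply: eq_big_seq => w /sP s_w; rewrite -scalerAr -scalerAl; congr (_ *: _).
have powE : g ^+ s * g ^ exp_sum k w = g ^+ absz (exp_sum k w + s%:Z).
  by rewrite [RHS]exprnP gez0_abs // addrC exprzDr.
by rewrite word_eval_pow // -[_ * g ^+ s * _]mulrA powE (power_coefs_eval u a2 bc).
Qed.

(** The shift [s = p + 1] is the least one that makes the indices positive for all
    exponent sums bounded below by [- p]; positivity matters because the degrees
    of the powers strictly increase only from index 1 on. *)
Lemma exists_identity k (p q : nat) :
  (forall w, nonconst_word P w ->
     exp_sum k w != 0 /\ - p%:Z <= exp_sum k w <= q%:Z) ->
  exists2 f : {poly R}, size f = (identity_degree p q).+1 &
    forall a b c u : A, a ^+ 2 = 0 -> b * c = 0 ->
      horner_alg (b * a * c * u) f = 0.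
Proof.
move=> kP; have wP w : w \in msupp P -> - p%:Z <= exp_sum k w <= q%:Z.
  have [->|w_neq1 Pw] := eqVneq w 1%g; first by rewrite exp_sum1; lia.
  by case: (kP w) => //; apply/andP.
pose idx (w : free_group m) := absz (exp_sum k w + p.+1%:Z).
have relP :
    relation (msupp P) (fun w => P@_w) idx square_zero_product power_poly.
  by apply: power_poly_relation => w /wP; lia.
have msupp1 : 1%g \in msupp P by rewrite -mcoeff_neq0.
have idx1 : idx 1%g = p.+1 by rewrite /idx exp_sum1 add0r.
have idxP : {in msupp P, forall w, w != 1%g ->
    [/\ 0 < idx w, idx w != p.+1 & idx w <= p.+1 + q]%N}.
  move=> w Pw w_neq1; have [|nz_w /andP[ge_w le_w]] := kP w; first exact/andP.
  by rewrite /idx; split; lia.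
have [f sf fP] := relation_poly (coef := fun w => P@_w) square_zero_product_sqr
  (fset_uniq _) msupp1 P1 idx1 idxP relP.
exists f => [|a b c u a2 bc]; last by apply: fP; exists a, b, c, u.
rewrite sf /identity_degree prednK // size_poly_gt0 monic_neq0 //.
by apply: (sieve_staircase (power_poly_staircase _)).1; rewrite leqnn.
Qed.

End Identity.

Theorem theorem2p1 :
  exists D : int -> int -> nat,
  forall (R : nzRingType) (A : unitAlgType R) (m : nat) (P : laurent R m),
    LPI A P ->
    P@_1%g != 0 ->
    (exists w, nonconst_word P w) ->
    (forall w, nonconst_word P w -> exists j, exp_var j w != 0) ->
    (forall (k : 'I_m -> nat) (l r : int),
       admissible P k -> min_exp_sum P k l -> max_exp_sum P k r ->
       exists2 f : {poly R}, size f = (D l r).+1 &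
         forall a b c u : A, a ^+ 2 = 0 -> b * c = 0 ->
           horner_alg (b * a * c * u) f = 0) /\
    (forall a b c : A, a ^+ 2 = 0 -> b * c = 0 ->
       satisfies_PI (right_ideal (b * a * c))).
Proof.
exists (fun l r => identity_degree (absz l) (absz r)) => R A m P lpiP P1 _ expP.
split=> [k l r [_ k_neq0 _] [_ minl] [_ maxr] | a b c a2 bc].
  apply: (exists_identity lpiP P1 (k := k)) => w Pw; split; first exact: k_neq0.
  by have := minl w Pw; have := maxr w Pw; lia.
(* The degree is free here, so one crude bound [N] on the absolute values of the
   exponent sums serves on both sides. *)
pose ws := [seq w <- msupp P | w != 1%g].
have wsE w : (w \in ws) = nonconst_word P w by rewrite mem_filter andbC.
have [w|k _ k_neq0] := @exists_nonzero_exp_sums m ws.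
  by rewrite wsE; apply: expP.
pose N := (\sum_(w <- ws) `|exp_sum k w|)%N.
have [w Pw|f sf fP] := exists_identity lpiP P1 (k := k) (p := N) (q := N).
  rewrite -wsE in Pw; split; first exact: k_neq0.
  have : (`|exp_sum k w| <= N)%N by rewrite /N (big_rem w) //= leq_addr.
  lia.
exists f => [|_ [u ->]]; last exact: fP.
by rewrite -size_poly_gt0 sf.
Qed.
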